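(* For every integer $\Delta\ge4$, there is a connected graph $G$ with maximum degree exactly $\Delta$ such that \[ \tau_D(G)>\frac{\Delta(\Delta-1)n+2m}{\Delta^2+1}, \] where $n=|V(G)|$ and $m=|E(G)|$.
   Context: All graphs are finite, simple and undirected. A set $T\subseteq V(G)$ is an identifying vertex cover if $e\cap T\neq\emptyset$ for every $e\in E(G)$ and the sets $e\cap T$ ($e\in E(G)$) are pairwise distinct; $\tau_D(G)$ is the minimum cardinality of an identifying vertex cover of $G$. *)

(* Defs.v *)
From mathcomp Require Import all_boot all_order all_algebra.

Set Implicit Arguments.
Unset Strict Implicit.
Unset Printing Implicit Defensive.

Record sgraph := SGraph {
  vertex :> finType;
  adj : rel vertex;
  adj_sym : symmetric adj;
  adj_irrefl : irreflexive adj
}.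

Section Graph.
Variable G : sgraph.

Definition edges : {set {set G}} :=
  [set [set p.1; p.2] | p : G * G & adj p.1 p.2].

Definition degree (x : G) : nat := #|[set y | adj x y]|.

Definition max_degree : nat := \max_(x : G) degree x.

Definition connected_graph : bool :=
  (0 < #|G|) && [forall x : G, forall y : G, connect (@adj G) x y].

Definition identifying_vertex_cover (A : {set G}) : bool :=
  [forall f in edges, f :&: A != set0] &&
  [forall f in edges, forall g in edges, (f != g) ==> (f :&: A != g :&: A)].

Lemma identifying_vertex_cover_setT : identifying_vertex_cover [set: G].
Proof.
apply/andP; split.
  apply/forall_inP => f /imsetP [p _ ->]; apply/set0Pn; exists p.1.
  by rewrite setIT set21.
apply/forall_inP => f _; apply/forall_inP => g _.
by rewrite !setIT; apply/implyP.
Qed.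

(* The default [set: G] satisfies the predicate by the lemma above, so this is
   a genuine minimum for every graph. *)
Definition tauD : nat :=
  #|[arg min_(A < [set: G] | identifying_vertex_cover A) #|A|]|.

End Graph.

(* Main.v *)
Require Import Defs.
From mathcomp Require Import all_boot all_order all_algebra.
From mathcomp Require Import zify lra.

Import GRing.Theory Num.Theory.
Local Open Scope ring_scope.

(** If any two distinct vertices of [G] are adjacent or have a common neighbour,
    an identifying vertex cover misses at most one vertex, so [tauD G] is at
    least [n - 1].  Take the Petersen graph with one vertex replaced by
    [Delta - 2] pairwise non-adjacent copies: this property is preserved, the
    maximum degree is [Delta], [n = Delta + 7] and [m = 3 * Delta + 6], and
    [(Delta^2 + 1) (n - 1) - Delta (Delta - 1) n - 2 m = 2 (Delta - 3) > 0]. *)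

Lemma tauD_ge (G : sgraph) (k : nat) :
  (forall A : {set G}, identifying_vertex_cover A -> (k <= #|A|)%N) ->
  (k <= tauD G)%N.
Proof.
move=> Hk; rewrite /tauD; case: arg_minnP => [|A hA _]; last exact: Hk.
exact: identifying_vertex_cover_setT.
Qed.

Lemma edge_in_edges {G : sgraph} {x y : G} : adj x y -> [set x; y] \in edges G.
Proof. by move=> xy; apply/imsetP; exists (x, y); rewrite ?inE. Qed.

Lemma setU1I_notin {T : finType} {A : {set T}} {x : T} (z : T) :
  x \notin A -> [set x; z] :&: A = [set z] :&: A.
Proof.
move=> /negPf xA.
by apply/setP => y; rewrite !inE; case: eqP => [->|]; rewrite ?xA ?andbF.
Qed.

(** Suppose [x] and [y] are distinct and both outside [A]. If they are adjacent, the edge between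
    them is not covered; otherwise their edges to a common neighbour [z] have the same trace
    [[set z] :&: A]. *)
Lemma tauD_diameter2 {G : sgraph} :
  (forall x y : G, adj x y \/ exists z, adj x z /\ adj y z) ->
  (#|G|.-1 <= tauD G)%N.
Proof.
move=> diam; apply: tauD_ge => A /andP[/forall_inP cov /forall_inP sep].
suff: (#|~: A| <= 1)%N by have := cardsC A; lia.
apply/card_le1P => x; rewrite inE => xA y; rewrite !inE.
apply/idP/eqP => [yA|-> //]; apply/eqP/negPn/negP => yx.
have [xy|[z [xz yz]]] := diam x y.
  have := cov _ (edge_in_edges xy).
  by rewrite setU1I_notin // setI_eq0 disjoints1 yA.
have /forall_inP/(_ _ (edge_in_edges yz))/implyP := sep _ (edge_in_edges xz).
rewrite !setU1I_notin // eqxx => /(_ _)/negP; apply=> //.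
(* The two edges do differ: [y] in [[set x; z]] would force [y = z], making [z] adjacent to
   itself. *)
apply/negP => /eqP/setP/(_ y); rewrite !inE eqxx (negPf yx) /= => /eqP yz'.
by move: yz; rewrite yz' adj_irrefl.
Qed.

(* Vertex 0 has the neighbours 1, 2, 3; the other six vertices form the
   hexagon 4-6-9-5-7-8. *)
Definition petersen_edges : seq (nat * nat) :=
  [:: (0, 1); (0, 2); (0, 3); (1, 4); (1, 5); (2, 6); (2, 7); (3, 8); (3, 9);
      (4, 6); (4, 8); (5, 7); (5, 9); (6, 9); (7, 8)]%N.

Definition petersen : rel nat :=
  fun i j => ((i, j) \in petersen_edges) || ((j, i) \in petersen_edges).

Lemma petersen_sym : symmetric petersen.
Proof. by move=> i j; rewrite /petersen orbC. Qed.

Lemma petersen_irrefl : irreflexive petersen.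
Proof. by move=> i; rewrite /petersen; do 10?[case: i => // i]. Qed.

Lemma petersen_diameter2 {i j : nat} : (i < 10)%N -> (j < 10)%N ->
  petersen i j \/
  exists2 k, (k < 10)%N & petersen i k /\ petersen j k.
Proof.
move=> i10 j10.
(* The check includes the diagonal [i = j], which later gives two copies of vertex 0 a common
   neighbour. *)
have /allP/(_ i)/[!mem_iota]/(_ i10)/allP/(_ j)/[!mem_iota]/(_ j10) :
  all (fun i => all (fun j => petersen i j ||
    has (fun k => petersen i k && petersen j k) (iota 0 10)) (iota 0 10))
    (iota 0 10) by vm_compute.
case/orP => [|/hasP[k]]; first by left.
by rewrite mem_iota => k10 /andP[ik jk]; right; exists k.
Qed.

Section ClonedPetersen.
Variable t : nat.

(** The original vertex 0 stays in the left summand, so it has [t + 1] copies in all, and [t] is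
    [Delta - 3]. *)
Definition cloned_vertex : finType := ('I_10 + 'I_t)%type.

(* The [t] vertices of the right summand are copies of vertex 0. *)
Definition label (x : cloned_vertex) : nat :=
  match x with inl i => i | inr _ => 0%N end.

Definition cloned_adj : rel cloned_vertex :=
  fun x y => petersen (label x) (label y).

Lemma cloned_adj_sym : symmetric cloned_adj.
Proof. by move=> x y; exact: petersen_sym. Qed.

Lemma cloned_adj_irrefl : irreflexive cloned_adj.
Proof. by move=> x; exact: petersen_irrefl. Qed.

Definition cloned_petersen : sgraph :=
  SGraph cloned_adj_sym cloned_adj_irrefl.

Lemma label_lt (x : cloned_vertex) : (label x < 10)%N.
Proof. by case: x => [i|//] /=. Qed.

Lemma card_cloned_petersen : #|cloned_petersen| = (10 + t)%N.
Proof. by rewrite card_sum !card_ord. Qed.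

Lemma sum_label (F : nat -> nat) :
  (\sum_(x : cloned_vertex) F (label x) = \sum_(i < 10) F i + t * F 0)%N.
Proof. by rewrite big_sumType /= sum_nat_const card_ord. Qed.

Lemma cloned_diameter2 (x y : cloned_petersen) :
  adj x y \/ exists z, adj x z /\ adj y z.
Proof.
have [xy|[k k10 [xk yk]]] := petersen_diameter2 (label_lt x) (label_lt y).
  by left.
by right; exists (inl (Ordinal k10)).
Qed.

Lemma connected_cloned_petersen : connected_graph cloned_petersen.
Proof.
apply/andP; split; first by rewrite card_cloned_petersen.
apply/forallP => x; apply/forallP => y.
have [xy|[z [xz yz]]] := cloned_diameter2 x y; first exact: connect1.
apply: (connect_trans (connect1 xz)); apply: connect1.
by rewrite adj_sym.
Qed.

Lemma degree_cloned_petersen (x : cloned_petersen) :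
  degree x = (3 + t * petersen (label x) 0)%N.
Proof.
rewrite /degree -sum1dep_card big_mkcond /=.
under eq_bigr => y _ do rewrite -[if _ then _ else _]/(nat_of_bool _).
rewrite (sum_label (fun j => petersen (label x) j)); congr addn.
rewrite -(big_mkord xpredT (fun j => petersen (label x) j : nat)).
have := label_lt x; move: (label x) => i.
by do 10?[case: i => [_|i]; first by rewrite unlock].
Qed.

Lemma max_degree_cloned_petersen : max_degree cloned_petersen = (3 + t)%N.
Proof.
apply/eqP; rewrite eqn_leq; apply/andP; split.
  apply/bigmax_leqP => x _; rewrite degree_cloned_petersen leq_add2l.
  by case: petersen; rewrite ?muln1 ?muln0.
(* Vertex 1 is a neighbour of vertex 0, hence of all its copies. *)
pose x : cloned_petersen := inl (inord 1).
have <- : degree x = (3 + t)%N.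
  by rewrite degree_cloned_petersen /= inordK // muln1.
exact: leq_bigmax.
Qed.

(** An upper bound suffices, as the edge count enters the final inequality only on the smaller side.
    Adjacent vertices have distinct labels, so each edge comes from an arc towards the larger label;
    counting arcs by their tails gives the bound. *)
Lemma card_edges_cloned_petersen :
  (#|edges cloned_petersen| <= 15 + 3 * t)%N.
Proof.
pose arcs := [set p : cloned_petersen * cloned_petersen |
                petersen (label p.1) (label p.2) && (label p.1 < label p.2)%N].
have sub : edges cloned_petersen \subset [set [set p.1; p.2] | p in arcs].
  apply/subsetP => _ /imsetP[[x y] /= xy ->].
  have xy' : petersen (label x) (label y) by move: xy; rewrite inE.
  have [lt|gt|eq] := ltngtP (label x) (label y).
  - by apply/imsetP; exists (x, y); rewrite // inE /= xy'.
  - apply/imsetP; exists (y, x); last by rewrite /= setUC.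
    by rewrite inE /= petersen_sym xy'.
  - by move: xy'; rewrite eq petersen_irrefl.
apply: leq_trans (subset_leq_card sub) _.
apply: leq_trans (leq_imset_card _ _) _.
rewrite -sum1dep_card big_mkcond /=.
rewrite -(pair_bigA _ (fun x y : cloned_vertex => if petersen (label x) (label y)
  && (label x < label y)%N then 1%N else 0%N)) /=.
pose out i j := (petersen i j && (i < j)%N) : nat.
rewrite (eq_bigr (fun x => \sum_(j < 10) out (label x) j)%N); last first.
  move=> x _; rewrite (sum_label (out (label x))).
  (* No arc ends at label 0, so the extra copies matter only as tails, with three arcs each. *)
  by rewrite [out _ 0%N]/out ltn0 andbF muln0 addn0.
rewrite (sum_label (fun i => \sum_(j < 10) out i j)%N).
under eq_bigr => i _ do rewrite -(big_mkord xpredT (out i)).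
rewrite -(big_mkord xpredT (out 0%N)).
rewrite -(big_mkord xpredT (fun i => \sum_(0 <= j < 10) out i j)%N).
by rewrite mulnC unlock.
Qed.

End ClonedPetersen.

Theorem corollary3p2 (Delta : nat) (hDelta : (4 <= Delta)%N) :
  exists G : sgraph,
    [/\ connected_graph G,
        max_degree G = Delta
      & (Delta%:R * (Delta%:R - 1) * #|G|%:R + 2%:R * #|edges G|%:R)
          / (Delta%:R ^+ 2 + 1) < (tauD G)%:R :> rat].
Proof.
have [t t_gt0 ->] : exists2 t, (0 < t)%N & Delta = (3 + t)%N.
  by exists (Delta - 3)%N; lia.
exists (cloned_petersen t); split.
- exact: connected_cloned_petersen.
- exact: max_degree_cloned_petersen.
have := tauD_diameter2 (cloned_diameter2 t).
rewrite card_cloned_petersen /= => tau_ge.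
have := card_edges_cloned_petersen t.
move: #|edges _| (tauD _) tau_ge => m tau tau_ge m_le.
rewrite ltr_pdivrMr; last by rewrite ltr_wpDl ?ltr01 ?sqr_ge0.
move: m_le tau_ge t_gt0; rewrite -!(ler_nat rat) !natrD.
set T := t%:R; set M := m%:R; set U := tau%:R => m_le tau_ge t_gt0.
(* This is [tau >= n - 1] multiplied by the cleared denominator; with it and the bound on [m], the
   remaining gap is [2 * T > 0]. *)
have : 0 <= (U - (9 + T)) * ((3 + T) ^+ 2 + 1).
  by apply: mulr_ge0; [rewrite subr_ge0 | rewrite addr_ge0 ?sqr_ge0].
nra.
Qed.
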